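(* Let $d\in\mathbb N$, $\mu\in\mathbb R^d$, let $\Sigma\in\mathbb R^{d\times d}$ be symmetric positive definite, let $X=(X^1,\dots,X^d)\sim N_d(\mu,\Sigma)$ with $X^i\in L$ for all $i$, let $r\in(-1,\infty)$, and let $\bar S$ be the market with $S^0_0=\dots=S^d_0=1$, $S^0_1=1+r$, $S^i_1=1+r+X^i$ for $i=1,\dots,d$. Let $\mathcal R$ be a law-invariant, cash-additive, positively homogeneous risk functional on $L$ satisfying the lower Fatou property. Let $Z\sim N(0,1)$ and suppose $\mathcal R(1)\neq 0$ and $\kappa_{\mathcal R}:=\mathcal R(Z)/|\mathcal R(1)|\in(0,\infty)$. Let $0<b\le a\le1$ and let $u(y)=y^a$ for $y\ge0$, $u(y)=-(-y)^b$ for $y<0$. Put $\mathrm{SR}_{\max}(X):=\sup_{\pi\in\mathbb R^d\setminus\{\mathbf 0\}}\frac{\pi^\top\mu}{\sqrt{\pi^\top\Sigma\pi}}=\sqrt{\mu^\top\Sigma^{-1}\mu}$. Then the following statements are equivalent: (a) $\mathrm{SR}_{\max}(X)<\kappa_{\mathcal R}$; (b) $(\mathcal E_u,\mathcal R)$-terminal-wealth portfolio selection is weakly well posed for $\bar S$; (c) $(\mathcal E_u,\mathcal R)$-terminal-wealth portfolio selection is well posed for $\bar S$.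
   Context: Setting. $(\Omega,\mathcal F,\mathbb P)$ is an atomless probability space. $L$ is a Riesz space of random variables (vector lattice for the $\mathbb P$-a.s. order) with $L^\infty\subset L\subset L^1$, which is law-invariant: if $Y\in L$ and $Z$ is a random variable on $(\Omega,\mathcal F,\mathbb P)$ with the same law as $Y$, then $Z\in L$. Constants are identified with constant random variables. Expected utility: $\mathcal E_u:L\to[-\infty,\infty)$, $\mathcal E_u(Y)=\mathbb E[u(Y)]$; here $\mathcal E_u(\infty):=\lim_{y\to\infty}u(y)=\infty$. A risk functional is a map $\mathcal R:L\to(-\infty,\infty]$ that is decreasing ($Y\le Z$ a.s. implies $\mathcal R(Y)\ge\mathcal R(Z)$) with $\mathcal R(c)\in\mathbb R$ for all constants $c>0$. Law-invariant: $\mathcal R(Y)=\mathcal R(Z)$ whenever $Y,Z\in L$ have the same distribution. Cash-additive: $\mathcal R(Y+c)=\mathcal R(Y)+\mathcal R(c)$ for $Y\in L$, $c\in\mathbb R$. Positively homogeneous: $\mathcal R(\lambda Y)=\lambda\mathcal R(Y)$ for $Y\in L$, $\lambda\in(0,\infty)$. Lower Fatou property: $\mathcal R(Y)\le\liminf_n\mathcal R(Y_n)$ whenever $Y_n,Y\in L$, $Y_n\to Y$ a.s. and $|Y_n|\le Z'$ a.s. for all $n$, for some $Z'\in L$. Problem. For $w\in(0,\infty)$ and $R_{\max}\in[\mathcal R(w(1+r)),\infty)$, $(\mathcal E_u,\mathcal R)$-terminal-wealth portfolio selection is: maximize $\mathcal E_u(\bar\theta\cdot\bar S_1)$ over $\bar\theta\in\mathbb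 R^{1+d}$ with $\bar\theta\cdot\bar S_0=w$ and $\mathcal R(\bar\theta\cdot\bar S_1)\le R_{\max}$. It is well posed for $\bar S$ if for every such $w$ and $R_{\max}$ a maximizer exists; it is weakly well posed for $\bar S$ if for every such $w$ and $R_{\max}$ the supremum is strictly less than $\mathcal E_u(\infty)$. *)

(* Defs.v *)
From HB Require Import structures.
From mathcomp Require Import all_boot all_order all_algebra.
From mathcomp Require Import all_classical all_reals all_analysis.
From mathcomp Require Import measurable_realfun.
Import Order.TTheory GRing.Theory Num.Theory.
Import numFieldNormedType.Exports.

Set Implicit Arguments.
Unset Strict Implicit.
Unset Printing Implicit Defensive.

Local Open Scope classical_set_scope.
Local Open Scope ring_scope.

Section Probability.
Context {disp : measure_display} {T : measurableType disp} {R : realType}.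
Variable P : probability T R.
Implicit Types Y Z V W : {RV P >-> R}.

Definition atomless : Prop :=
  forall A : set T, measurable A -> (0 < P A)%E ->
    exists B : set T,
      [/\ measurable B, B `<=` A, (0 < P B)%E & (P B < P A)%E].

Definition cst_rv (c : R) : {RV P >-> R} := cst c.

Definition le_as Y Z : Prop := {ae P, forall x, Y x <= Z x}.

(* Laws are compared on Borel sets only: a measure is a total function on
   sets, unconstrained outside the sigma-algebra. *)
Definition has_law Y (nu : set R -> \bar R) : Prop :=
  forall A : set R, measurable A -> distribution P Y A = nu A.

Definition same_law Y Z : Prop := has_law Y (distribution P Z).

(* N(m, v), parametrized by the variance v >= 0 (normal_prob takes the standard
   deviation); N(m, 0) is the Dirac mass at m. *)
Definition normal_law (m v : R) : set R -> \bar R :=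
  if v == 0 then (\d_m : set R -> \bar R) else normal_prob m (Num.sqrt v).

(* X ~ N_d(mu, Sigma): every linear combination of the components is univariate
   normal, with mean pi^T mu and variance pi^T Sigma pi. *)
Definition multivariate_normal (d : nat) (mu : 'cV[R]_d) (Sigma : 'M[R]_d)
    (X : 'I_d -> {RV P >-> R}) : Prop :=
  forall p : 'cV[R]_d,
    has_law (\sum_(i < d) p i 0 *: X i)
      (normal_law ((p^T *m mu) 0 0) ((p^T *m Sigma *m p) 0 0)).

(* A set of random variables, standing for a space of a.s. equivalence classes:
   law-invariance makes it closed under a.s. equality. *)
Record law_invariant_riesz_space (L : set {RV P >-> R}) : Prop := {
  riesz_linear : forall (a : R) Y Z, L Y -> L Z -> L (a *: Y + Z);
  riesz_sup : forall Y Z, L Y -> L Z -> exists W,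
    [/\ L W, le_as Y W, le_as Z W &
        forall V, L V -> le_as Y V -> le_as Z V -> le_as W V];
  riesz_inf : forall Y Z, L Y -> L Z -> exists W,
    [/\ L W, le_as W Y, le_as W Z &
        forall V, L V -> le_as V Y -> le_as V Z -> le_as V W];
  riesz_Linfty : forall Y, (Y : T -> R) \in Lfun P +oo%E -> L Y;
  riesz_L1 : forall Y, L Y -> (Y : T -> R) \in Lfun P 1%E;
  riesz_law : forall Y Z, L Y -> same_law Z Y -> L Z }.

(* Maps from L are total functions on random variables, whose values outside L
   are never constrained. *)
Section RiskFunctional.
Variables (L : set {RV P >-> R}) (rho : {RV P >-> R} -> \bar R).

Record risk_functional : Prop := {
  risk_gtNy : forall Y, L Y -> (-oo < rho Y)%E;
  risk_decreasing : forall Y Z, L Y -> L Z -> le_as Y Z -> (rho Z <= rho Y)%E;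
  risk_cst : forall c : R, 0 < c -> rho (cst_rv c) \is a fin_num }.

Definition law_invariant : Prop :=
  forall Y Z, L Y -> L Z -> same_law Y Z -> rho Y = rho Z.

Definition cash_additive : Prop :=
  forall Y (c : R), L Y -> rho (Y + cst_rv c) = (rho Y + rho (cst_rv c))%E.

Definition positively_homogeneous : Prop :=
  forall Y (l : R), L Y -> 0 < l -> rho (l *: Y) = (l%:E * rho Y)%E.

Definition lower_fatou : Prop :=
  forall (Yn : nat -> {RV P >-> R}) Y Z,
    (forall n, L (Yn n)) -> L Y -> L Z ->
    {ae P, forall x, (fun n => Yn n x) @ \oo --> Y x} ->
    (forall n, {ae P, forall x, `|Yn n x| <= Z x}) ->
    (rho Y <= limn_einf (fun n => rho (Yn n)))%E.

End RiskFunctional.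

Definition expected_utility (u : R -> R) Y : \bar R := 'E_P[u \o Y]%E.

Definition expected_utility_infty (u : R -> R) : \bar R :=
  lim ((u y)%:E @[y --> +oo]).

Section PortfolioSelection.
Variables (n : nat) (S0 : 'I_n -> R) (S1 : 'I_n -> {RV P >-> R}).
Variables (r : R) (u : R -> R) (rho : {RV P >-> R} -> \bar R).

Definition initial_wealth (theta : 'I_n -> R) : R := \sum_(i < n) theta i * S0 i.

Definition terminal_wealth (theta : 'I_n -> R) : {RV P >-> R} :=
  \sum_(i < n) theta i *: S1 i.

Definition admissible (w Rmax : R) : set ('I_n -> R) :=
  [set theta | initial_wealth theta = w
             /\ (rho (terminal_wealth theta) <= Rmax%:E)%E].

Definition well_posed : Prop :=
  forall w Rmax : R, 0 < w -> (rho (cst_rv (w * (1 + r))) <= Rmax%:E)%E ->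
    exists2 theta, admissible w Rmax theta &
      forall eta, admissible w Rmax eta ->
        (expected_utility u (terminal_wealth eta)
           <= expected_utility u (terminal_wealth theta))%E.

Definition weakly_well_posed : Prop :=
  forall w Rmax : R, 0 < w -> (rho (cst_rv (w * (1 + r))) <= Rmax%:E)%E ->
    (ereal_sup [set expected_utility u (terminal_wealth theta)
               | theta in admissible w Rmax] < expected_utility_infty u)%E.

End PortfolioSelection.

Definition market_S0 (d : nat) : 'I_d.+1 -> R := fun=> 1.

Definition market_S1 (d : nat) (r : R) (X : 'I_d -> {RV P >-> R}) :
    'I_d.+1 -> {RV P >-> R} :=
  fun i => if unlift ord0 i is Some j then cst_rv (1 + r) + X j
           else cst_rv (1 + r).

End Probability.

Section GaussianModel.
Context {R : realType}.

Definition power_utility (a b : R) (y : R) : R :=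
  if 0 <= y then y `^ a else - ((- y) `^ b).

Definition sym_posdef (d : nat) (Sigma : 'M[R]_d) : Prop :=
  Sigma^T = Sigma /\
  forall p : 'cV[R]_d, p != 0 -> 0 < (p^T *m Sigma *m p) 0 0.

Definition SRmax (d : nat) (mu : 'cV[R]_d) (Sigma : 'M[R]_d) : R :=
  sup [set (p^T *m mu) 0 0 / Num.sqrt ((p^T *m Sigma *m p) 0 0)
      | p in [set p : 'cV[R]_d | p != 0]].

End GaussianModel.

(* Main.v *)
(* A portfolio with risky part [p] has Gaussian wealth with mean [c + p^T mu] and
   deviation [s = sqrt (p^T Sigma p)], so its risk is
   [|rho 1| (kappa s - c - p^T mu)].  If [SRmax < kappa], Cauchy-Schwarz for the
   form [Sigma] bounds [s] on the admissible set, which is then compact, and the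
   expected utility is continuous in [p]; hence a maximizer exists, and its
   value is finite because wealth is integrable.  If [SRmax >= kappa], all
   positive multiples of [Sigma^-1 mu] are admissible, and along this ray the
   expected utility is at least [t^a A - t^b B], where [A = E Y_+^a] and
   [B = E Y_-^b] for the excess wealth [Y]; since [Y] is symmetric about a
   positive mean, [A > E Y_-^a], so the bound tends to infinity. *)

Require Import Defs.
From HB Require Import structures.
From mathcomp Require Import all_boot all_order all_algebra.
From mathcomp Require Import all_classical all_reals all_analysis.
From mathcomp Require Import measurable_realfun.
From mathcomp Require Import ring lra.
From mathcomp Require ess_sup_inf.
Import Order.TTheory GRing.Theory Num.Theory.
Import numFieldNormedType.Exports.

Local Open Scope classical_set_scope.
Local Open Scope ring_scope.

Set Implicit Arguments.
Unset Strict Implicit.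
Unset Printing Implicit Defensive.

(** * Affine images of the normal law *)

Lemma measurable_affine (R : realType) (m s : R) :
  measurable_fun [set: R] (fun z => m + s * z).
Proof. by apply: measurable_funD => //; apply: measurable_funM. Qed.

(** Bundled as a measure so that uniqueness of Lebesgue measure and change of variables apply to it;
    transparent so that its values compute. *)
Definition scaled_pushforward (R : realType) (k : {nonneg R})
    (g : measurableTypeR R -> measurableTypeR R)
    (mg : measurable_fun [set: measurableTypeR R] g) :
  {measure set (measurableTypeR R) -> \bar R}.
Proof. by refine (mscale k (pushforward lebesgue_measure g)). Defined.

(** Both sides are measures in [A]. The preimage of a half-open interval is a half-open interval
    with length divided by [s], and these intervals determine Lebesgue measure. *)
Lemma lebesgue_measure_affine (R : realType) (m s : R) (A : set R) :
  0 < s -> measurable A ->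
  lebesgue_measure A =
    (s%:E * lebesgue_measure ((fun z => m + s * z)%R @^-1` A))%E.
Proof.
move=> s0 mA; have s0' : 0 <= s by exact: ltW.
pose k := NngNum s0'; pose g := fun z : R => m + s * z.
pose nu := scaled_pushforward k (measurable_affine m s).
have := @lebesgue_measure_unique R nu.
move/(_ _ A mA); apply => _ [[x y] _ <-].
transitivity (s%:E * lebesgue_measure (g @^-1` `]x, y]))%E; last by [].
have -> : g @^-1` `]x, y] =
          `](x - m) / s, (y - m) / s]%classic.
  apply/seteqP; split => z/=; rewrite /g !in_itv/= ltr_pdivrMr// ler_pdivlMr//.
    by case/andP => ? ?; apply/andP; split; lra.
  by case/andP => ? ?; apply/andP; split; lra.
rewrite !lebesgue_measure_itv/= !lte_fin ltr_pM2r ?invr_gt0// ltrD2r.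
case: ifP => _; last by rewrite mule0.
rewrite -!EFinD -EFinM; congr EFin.
by field; rewrite gt_eqF.
Qed.

(** The Jacobian [s] cancels the factor [1 / s] in the peak of the density. *)
Lemma normal_pdf_affine (R : realType) (m s z : R) : 0 < s ->
  s * normal_pdf m s (m + s * z) = normal_pdf 0 1 z.
Proof.
move=> s0; rewrite !normal_pdfE ?gt_eqF//.
rewrite /normal_peak/normal_fun mulrA; congr (_ * _).
  rewrite -(mulr_natr (_ * pi)) -mulrA sqrtrM ?sqr_ge0// sqrtr_sqr gtr0_norm//.
  rewrite expr1n mul1r invfM mulrA divff ?gt_eqF// mul1r mulr_natr//.
congr expR; rewrite expr1n subr0 addrAC subrr add0r exprMn.
rewrite -(mulr_natr (s ^+ 2)) -(mulr_natr 1); field.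
by rewrite gt_eqF.
Qed.

Lemma normal_prob_affine (R : realType) (m s : R) (A : set R) :
  0 < s -> measurable A ->
  normal_prob m s A = normal_prob 0 1 ((fun z => m + s * z) @^-1` A).
Proof.
move=> s0 mA; have s0' : 0 <= s by exact: ltW.
pose k := NngNum s0'; pose g := fun z : R => m + s * z.
have mg : measurable_fun setT g by exact: measurable_affine.
pose nu := scaled_pushforward k mg.
have mpdf D a c : measurable_fun D (fun x : R => (normal_pdf a c x)%:E).
  apply/measurable_EFinP.
  exact: measurable_funS (measurable_normal_pdf a c).
(* Writing Lebesgue measure as a scaled image measure turns the substitution into integration
   against a push-forward. *)
rewrite /normal_prob (eq_measure_integral nu); last first.
  by move=> B mB _; exact: (lebesgue_measure_affine m s0 mB).
rewrite ge0_integral_mscale//=; [|exact: mpdf|]; last first.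
  by move=> x _; rewrite lee_fin normal_pdf_ge0.
rewrite ge0_integral_pushforward//; [|exact: mpdf|]; last first.
  by move=> x _; rewrite lee_fin normal_pdf_ge0.
have mgA : measurable (g @^-1` A) by rewrite -[X in measurable X]setTI; exact: measurable_affine.
rewrite -ge0_integralZl//=.
- apply: eq_integral => z _.
  by rewrite -EFinM normal_pdf_affine.
- apply/measurable_EFinP; apply: measurableT_comp.
    exact: measurable_normal_pdf.
  by apply: (@measurable_funS _ _ _ _ setT) => //; exact: measurable_affine.
- by move=> x _; rewrite lee_fin normal_pdf_ge0.
Qed.

(** * The power utility *)

Section power_utility.
Context {R : realType}.
Implicit Types a b m x y t : R.

Lemma max0_ge0 x : 0 <= Num.max x 0.
Proof. by rewrite le_max lexx orbT. Qed.

Lemma ler_max0 x y : x <= y -> Num.max x 0 <= Num.max y 0.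
Proof. by move=> xy; rewrite ge_max !le_max xy lexx orbT. Qed.

(** Separates gains from losses. Positive exponents make the inactive part vanish, since zero to the
    power zero is one. *)
Lemma power_utilityE a b y : 0 < a -> 0 < b ->
  power_utility a b y = Num.max y 0 `^ a - Num.max (- y) 0 `^ b.
Proof.
move=> a0 b0; rewrite /power_utility; case: ifPn => [y0|].
  rewrite (max_idPl y0) [X in _ - X `^ _](max_idPr _) ?oppr_le0//.
  by rewrite powR0 ?gt_eqF// subr0.
rewrite -ltNge => /ltW y0; rewrite (max_idPr y0) powR0 ?gt_eqF// sub0r.
by rewrite (max_idPl _)// oppr_ge0.
Qed.

(** After division by [x + y], the two fractions lie in the unit interval, where the power [a] only
    increases them, and they sum to one. *)
Lemma powR_subadditive a x y : 0 < a -> a <= 1 -> 0 <= x -> 0 <= y ->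
  (x + y) `^ a <= x `^ a + y `^ a.
Proof.
move=> a0 a1 x0 y0; have [xy0|xy0] := eqVneq (x + y) 0.
  by rewrite xy0 powR0 ?gt_eqF// addr_ge0// powR_ge0.
have xy : 0 < x + y by rewrite lt0r xy0 addr_ge0.
have le_powR p : 0 <= p -> p <= x + y -> p / (x + y) <= (p / (x + y)) `^ a.
  rewrite le_eqVlt => /predU1P[<-|p0 pxy]; first by rewrite mul0r powR_ge0.
  by rewrite ger1_powR// divr_gt0//= ler_pdivrMr// mul1r.
have -> : x `^ a + y `^ a =
    (x + y) `^ a * ((x / (x + y)) `^ a + (y / (x + y)) `^ a).
  rewrite mulrDr -!powRM ?divr_ge0 ?addr_ge0//.
  by congr (_ `^ _ + _ `^ _); rewrite mulrC divfK.
rewrite ler_peMr ?powR_ge0//.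
apply: le_trans (lerD (le_powR x x0 _) (le_powR y y0 _)).
- by rewrite -mulrDl divff.
- by rewrite lerDl.
- by rewrite lerDr.
Qed.

(** For [y <= x], this is subadditivity applied to [x = y + (x - y)]. *)
Lemma ler_dist_powR a x y : 0 < a -> a <= 1 -> 0 <= x -> 0 <= y ->
  `|x `^ a - y `^ a| <= `|x - y| `^ a.
Proof.
move=> a0 a1; wlog : x y / y <= x.
  move=> H x0 y0; have [|/ltW] := leP y x => [/H|/H]; first exact.
  by rewrite distrC (distrC x); apply.
move=> yx x0 y0; rewrite !ger0_norm ?subr_ge0//; last first.
  by rewrite ge0_ler_powR ?nnegrE// ltW.
rewrite lerBlDl -[in leLHS](subrKC y x).
by apply: powR_subadditive; rewrite ?subr_ge0.
Qed.

(** With [t0] the point whose power is [e] and [s = t / t0], the claim says that the power of [s] is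
    at most [1 + s]. The slack [e] absorbs the slope at zero, infinite when [a < 1]. *)
Lemma powR_le_affine a (e : R) : 0 < a -> a <= 1 -> 0 < e ->
  exists2 C : R, 0 <= C & forall t, 0 <= t -> t `^ a <= e + C * t.
Proof.
move=> a0 a1 e0; pose t0 := e `^ a^-1.
have t00 : 0 < t0 by exact: powR_gt0.
have t0a : t0 `^ a = e by rewrite -powRrM mulVf ?gt_eqF// powRr1// ltW.
exists (e / t0) => [|t tge0]; first by rewrite divr_ge0// ltW.
have -> : t `^ a = e * (t / t0) `^ a.
  rewrite -t0a -(powRM _ (ltW t00)) ?divr_ge0 ?(ltW t00)//.
  by rewrite mulrC divfK// gt_eqF.
rewrite -mulrA -[X in X + _]mulr1 -mulrDr ler_pM2l// (mulrC _ t).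
have [tt0|tt0] := leP 1 (t / t0).
  by rewrite (le_trans (ler1_powR _ _))// lerDr.
rewrite (@le_trans _ _ 1)//; last by rewrite lerDl divr_ge0// ltW.
have := @ge0_ler_powR _ a (ltW a0) (t / t0) 1; rewrite powR1; apply.
- by rewrite nnegrE divr_ge0// ltW.
- by rewrite nnegrE.
- exact: ltW.
Qed.

(* Dividing by [t `^ b], the claim reduces to [t `^ (a - b) * A - B >= M] for
   some [t >= 1], unless [a = b]. *)
Lemma powR_difference_unbounded a b (A B M : R) :
  0 < b -> b <= a -> 0 < A -> 0 <= B -> (a = b -> B < A) ->
  exists2 t : R, 0 <= t & M <= t `^ a * A - t `^ b * B.
Proof.
move=> b0 ba A0 B0 AB; have a0 : 0 < a by exact: lt_le_trans ba.
have [eab|nab] := eqVneq a b.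
  subst b; have {}AB : 0 < A - B by rewrite subr_gt0 AB.
  (* The witness is the [a]-th root of [c], so its scaled difference is [c * (A - B) = |M|]. *)
  pose c := `|M| / (A - B).
  have c0 : 0 <= c by rewrite divr_ge0// ltW.
  exists (c `^ a^-1); first exact: powR_ge0.
  rewrite -powRrM mulVf ?gt_eqF// powRr1// -mulrBr divfK ?ler_norm//.
  by rewrite gt_eqF.
(* Chosen so that [c * A - B = A + |M|]; also [c >= 1] forces [t >= 1], so the common factor, the
   power [b] of [t], only enlarges this value. *)
pose c := 1 + (`|M| + B) / A.
have c1 : 1 <= c by rewrite lerDl divr_ge0 ?addr_ge0// ltW.
have c0 : 0 <= c by exact: le_trans c1.
have ba' : 0 < a - b by rewrite subr_gt0 lt_neqAle ba eq_sym nab.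
pose t := c `^ (a - b)^-1.
have powR_ge1 x y : 0 <= y -> 1 <= x -> 1 <= x `^ y.
  move=> y0 x1; have := @ge0_ler_powR R y y0 1 x; rewrite powR1; apply => //.
  - by rewrite nnegrE.
  - by rewrite nnegrE (le_trans _ x1).
have t1 : 1 <= t by apply: powR_ge1; rewrite ?invr_ge0// ltW.
have tb1 : 1 <= t `^ b by apply: powR_ge1; rewrite // ltW.
exists t; first exact: le_trans t1.
have -> : t `^ a = t `^ b * c.
  rewrite -[in LHS](subrK b a) addrC powRD; last first.
    by rewrite (gt_eqF (lt_le_trans _ t1))// implybT.
  by congr (_ * _); rewrite /t -powRrM mulVf ?gt_eqF// powRr1.
rewrite -mulrA -mulrBr.
have -> : c * A - B = A + `|M|.
  by rewrite /c mulrDl mul1r divfK ?gt_eqF//; lra.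
apply: (@le_trans _ _ (A + `|M|)).
  by rewrite (le_trans (ler_norm _))// lerDr ltW.
by rewrite ler_peMl// addr_ge0// ltW.
Qed.

(* A modulus of continuity of the form [e + C |x - y|] turns an L^1 bound on
   the difference of two random variables into a bound on the difference of
   their expected utilities. *)
Lemma power_utility_modulus a b (e : R) :
  0 < a -> a <= 1 -> 0 < b -> b <= 1 -> 0 < e ->
  exists2 C : R, 0 <= C & forall x y,
    `|power_utility a b x - power_utility a b y| <= e + C * `|x - y|.
Proof.
move=> a0 a1 b0 b1 e0; have e20 : 0 < e / 2 by rewrite divr_gt0.
have [C C0 HC] := powR_le_affine a0 a1 e20.
have [D D0 HD] := powR_le_affine b0 b1 e20.
exists (C + D) => [|x y]; first exact: addr_ge0.
(* The positive part is 1-Lipschitz, so increments of gains and of losses are both controlled by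
   [|x - y|]. *)
have dmax (p q : R) : `|Num.max p 0 - Num.max q 0| <= `|p - q|.
  have h1 := ler_norm (p - q); have := ler_norm (q - p); rewrite distrC => h2.
  have h0 := normr_ge0 (p - q).
  by rewrite /Num.max ler_norml; case: ltP => p0; case: ltP => q0;
    apply/andP; split; lra.
rewrite !power_utilityE// opprD opprK addrACA.
apply: le_trans (ler_normD _ _) _.
rewrite (addrC _ (Num.max (- y) 0 `^ b)).
apply: le_trans (lerD (ler_dist_powR a0 a1 (max0_ge0 _) (max0_ge0 _))
                      (ler_dist_powR b0 b1 (max0_ge0 _) (max0_ge0 _))) _.
apply: le_trans (lerD (HC _ (normr_ge0 _)) (HD _ (normr_ge0 _))) _.
have h1 := ler_wpM2l C0 (dmax x y).
have := ler_wpM2l D0 (dmax (- y) (- x)); rewrite opprK (addrC _ x) => h2.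
lra.
Qed.

(** The modulus of continuity at the base point zero. Linear growth makes the utility of integrable
    wealth integrable. *)
Lemma power_utility_growth a b : 0 < a -> a <= 1 -> 0 < b -> b <= 1 ->
  exists2 C : R, 0 <= C & forall y, `|power_utility a b y| <= 1 + C * `|y|.
Proof.
move=> a0 a1 b0 b1.
have [C C0 H] := power_utility_modulus a0 a1 b0 b1 ltr01.
exists C => // y; move: (H y 0); rewrite subr0.
by rewrite (_ : power_utility a b 0 = 0) ?subr0// /power_utility lexx powR0// gt_eqF.
Qed.

Lemma ler_power_utility a b : 0 < a -> 0 < b ->
  {homo power_utility a b : x y / x <= y}.
Proof.
move=> a0 b0 x y xy; rewrite !power_utilityE//.
by rewrite lerB// ge0_ler_powR ?nnegrE ?max0_ge0 ?ler_max0 ?lerN2// ltW.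
Qed.

(** If [y <= 0], the loss term strictly decreases; otherwise the gain term strictly increases while
    the loss term does not grow. *)
Lemma ltr_power_utility a b : 0 < a -> 0 < b ->
  {homo power_utility a b : x y / x < y}.
Proof.
move=> a0 b0 x y xy; have [y0|y0] := leP y 0.
  have x0 : x < 0 by exact: lt_le_trans xy y0.
  rewrite !power_utilityE// (max_idPr (ltW x0)) (max_idPr y0) !powR0 ?gt_eqF//.
  rewrite !sub0r ltrN2 gt0_ltr_powR ?nnegrE ?max0_ge0//.
  by rewrite !(max_idPl _) ?oppr_ge0// ?ltrN2// ltW.
rewrite !power_utilityE// ltr_leB//.
  rewrite gt0_ltr_powR ?nnegrE ?max0_ge0//.
  by rewrite gt_max lt_max xy/= lt_max y0.
by rewrite ge0_ler_powR ?nnegrE ?max0_ge0 ?ler_max0 ?lerN2// ltW.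
Qed.

Lemma power_utilityN a y : 0 < a ->
  power_utility a a (- y) = - power_utility a a y.
Proof. by move=> a0; rewrite !power_utilityE// opprK opprB. Qed.

(** By oddness the sum is the increment of the utility from [- y] to [- y + 2 * m]. *)
Lemma power_utility_reflection_gt0 a m y : 0 < a -> 0 < m ->
  0 < power_utility a a y + power_utility a a (- y + 2 * m).
Proof.
move=> a0 m0; rewrite -[power_utility a a y]opprK -power_utilityN// addrC subr_gt0.
by apply: ltr_power_utility => //; rewrite ltrDl mulr_gt0.
Qed.

Lemma measurable_max0_powR (a : R) :
  measurable_fun [set: R] (fun y : R => Num.max y 0 `^ a).
Proof.
have h : measurable_fun [set: R] (fun y : R => Num.max y 0).
  by apply: measurable_maxr.
exact: (measurableT_comp (measurable_powR a) h).
Qed.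

Lemma measurable_power_utility a b : 0 < a -> 0 < b ->
  measurable_fun [set: R] (power_utility a b).
Proof.
move=> a0 b0.
rewrite (_ : power_utility a b =
    (fun y => Num.max y 0 `^ a - Num.max (- y) 0 `^ b)); last first.
  by apply/funext => y; exact: power_utilityE.
apply: measurable_funB; first exact: measurable_max0_powR.
exact: (measurableT_comp (measurable_max0_powR b) (@oppr_measurable R setT)).
Qed.

Lemma power_utility_cvgy a b : 0 < a -> power_utility a b y @[y --> +oo] --> +oo.
Proof.
move=> a0; apply/cvgryPge => A; near=> y.
have y0 : 0 <= y by near: y; exact: nbhs_pinfty_ge.
rewrite /power_utility y0.
rewrite (@le_trans _ _ `|A|) ?ler_norm//.
have -> : `|A| = (`|A| `^ a^-1) `^ a.
  by rewrite -powRrM mulVf ?gt_eqF// powRr1.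
apply: ge0_ler_powR.
- exact: ltW.
- by rewrite nnegrE powR_ge0.
- by rewrite nnegrE.
- by near: y; apply: nbhs_pinfty_ge; rewrite num_real.
Unshelve. all: by end_near. Qed.

Lemma expected_utility_infty_power a b : 0 < a ->
  expected_utility_infty (power_utility a b) = +oo%E.
Proof.
move=> a0; rewrite /expected_utility_infty; apply/cvg_lim => //.
by apply/cvgeryP; exact: power_utility_cvgy.
Qed.

End power_utility.

(** * Laws and integrals of random variables *)

Section random_variables.
Context {disp : measure_display} {T : measurableType disp} {R : realType}.
Variable P : probability T R.
Implicit Types Y Z : {RV P >-> R}.

Lemma Lfun_pinfty_cst (c : R) : (cst_rv P c : T -> R) \in Lfun P +oo%E.
Proof.
rewrite inE/=; apply/andP; split; rewrite inE//=.
rewrite /finite_norm unlock; case: ifPn => [P0|_]; last by rewrite ltry.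
rewrite (_ : abse \o _ = cst `|c|%:E); last by apply/funext.
by rewrite ess_sup_inf.ess_sup_cst ?ltry.
Qed.

Lemma integrable_linear_growth (f : R -> R) (C : R) Y :
  measurable_fun [set: R] f -> 0 <= C -> (forall y, `|f y| <= 1 + C * `|y|) ->
  P.-integrable setT (EFin \o Y) -> P.-integrable setT (EFin \o (f \o Y)).
Proof.
move=> mf C0 fC iY.
have iN : P.-integrable setT (fun x => (`|Y x|)%:E) by exact: integrable_norm.
apply: (@le_integrable _ _ _ _ _ _ _ (fun x => 1%:E + C%:E * (`|Y x|)%:E)%E) => //.
- by apply/measurable_EFinP; apply: measurableT_comp.
- move=> x _ /=; rewrite lee_fin (le_trans (fC _))// ler_norm//.
- apply: integrableD => //; first exact: finite_measure_integrable_cst.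
  exact: integrableZl.
Qed.

(** A zero integral would make [f] vanish almost everywhere, so the whole space would be a null
    set. *)
Lemma Rintegral_gt0 (f : T -> R) : P.-integrable setT (EFin \o f) ->
  (forall x, 0 < f x) -> 0 < \int[P]_x f x.
Proof.
move=> intf f0; rewrite lt0r Rintegral_ge0; last by move=> x _; exact: ltW.
rewrite andbT; apply/eqP => If0.
have mf : measurable_fun setT (EFin \o f) by case/integrableP: intf.
have /(ae_eq_integral_abs _ measurableT mf) : (\int[P]_x `|(EFin \o f) x| = 0)%E.
  rewrite (eq_integral (EFin \o f)); last first.
    by move=> x _ /=; rewrite gtr0_norm.
  by rewrite -[LHS]fineK ?integrable_fin_num//; congr EFin.
move=> [N [mN PN /(_ _ _)] fN].
have : P [set: T] = 0%E.
  apply/eqP; rewrite eq_le measure_ge0 andbT -PN le_measure ?inE//.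
  by move=> x _; apply: fN => /= /(_ I) [] fx0; have := f0 x; rewrite fx0 ltxx.
by rewrite probability_setT => /eqP; rewrite onee_eq0.
Qed.

(** Both are integrals of [f] against distributions, and an integral depends on its measure only
    through measurable sets. *)
Lemma same_law_Rintegral (f : R -> R) Y Z : same_law Y Z ->
  measurable_fun [set: R] f -> P.-integrable setT (EFin \o (f \o Y)) ->
  P.-integrable setT (EFin \o (f \o Z)) ->
  \int[P]_x f (Y x) = \int[P]_x f (Z x).
Proof.
move=> YZ mf iY iZ; rewrite /Rintegral; congr fine.
have mEf : measurable_fun setT (EFin \o f) by exact/measurable_EFinP.
rewrite -[LHS](integral_distribution mEf iY) -[RHS](integral_distribution mEf iZ).
by apply: eq_measure_integral => A mA _; exact: YZ.
Qed.

Lemma expected_utility_Rintegral (u : R -> R) Y :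
  P.-integrable setT (EFin \o (u \o Y)) ->
  expected_utility u Y = (\int[P]_x u (Y x))%:E.
Proof.
by move=> iY; rewrite /expected_utility unlock fineK// integrable_fin_num.
Qed.

(** Expresses every normal variable through the single variable [Z]. For [v = 0] the right-hand side
    is constant, matching the Dirac mass. *)
Lemma same_law_normal (m v : R) Y Z : 0 <= v ->
  has_law Y (normal_law m v) -> has_law Z (normal_law 0 1) ->
  same_law Y (Num.sqrt v *: Z + cst_rv P m).
Proof.
move=> v0 lY lZ A mA; rewrite lY// /distribution/pushforward/= /normal_law.
have [->|v0'] := eqVneq v 0.
  rewrite sqrtr0 diracE.
  have -> : (0 *: Z + cst_rv P m) @^-1` A = if m \in A then setT else set0.
    apply/seteqP; split => x /=; rewrite scale0r add0r;
      by case: ifPn => //=; rewrite ?in_setE ?notin_setE.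
  by case: ifP; rewrite ?probability_setT ?measure0.
have s0 : 0 < Num.sqrt v by rewrite sqrtr_gt0 lt0r v0'.
rewrite normal_prob_affine//.
have mg := measurable_affine m (Num.sqrt v).
have := lZ ((fun z => m + Num.sqrt v * z) @^-1` A).
rewrite /normal_law oner_eq0 sqrtr1 /distribution/pushforward/= => <-.
  by congr (P _); apply/seteqP; split => x /=; rewrite addrC.
by rewrite -[X in measurable X]setTI; exact: mg.
Qed.

Lemma same_law_affine (k c : R) Y Z : same_law Y Z ->
  same_law (P := P) (k *: Y + cst_rv P c) (k *: Z + cst_rv P c).
Proof.
move=> YZ A mA; have mg := measurable_affine c k.
have := YZ ((fun z => c + k * z) @^-1` A).
rewrite /distribution/pushforward/=.
have kcE (W : {RV P >-> R}) : (k *: W + cst_rv P c) @^-1` A =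
    W @^-1` ((fun z => c + k * z) @^-1` A).
  by apply/seteqP; split => x /=; rewrite addrC.
rewrite !kcE; apply.
by rewrite -[X in measurable X]setTI; exact: mg.
Qed.

Lemma same_law_sym Y Z : same_law Y Z -> same_law Z Y.
Proof. by move=> YZ A mA; rewrite YZ. Qed.

Lemma same_law_trans Y Z W : same_law Y Z -> same_law Z W -> same_law Y W.
Proof. by move=> YZ ZW A mA; rewrite YZ// ZW. Qed.

End random_variables.

(** * Expected power utility of a symmetric random variable *)

Section unbounded_utility.
Context {disp : measure_display} {T : measurableType disp} {R : realType}.
Variable P : probability T R.
Implicit Types Y Z : {RV P >-> R}.

Lemma integrable_power_utility (a b : R) Y :
  0 < a -> a <= 1 -> 0 < b -> b <= 1 -> P.-integrable setT (EFin \o Y) ->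
  P.-integrable setT (EFin \o (power_utility a b \o Y)).
Proof.
move=> a0 a1 b0 b1 iY; have [C C0 uC] := power_utility_growth a0 a1 b0 b1.
by apply: (integrable_linear_growth _ C0) => //; exact: measurable_power_utility.
Qed.

Lemma integrable_max0_powR (a : R) Y : 0 < a -> a <= 1 ->
  P.-integrable setT (EFin \o Y) ->
  P.-integrable setT (EFin \o ((fun y : R => Num.max y 0 `^ a) \o Y)).
Proof.
move=> a0 a1 iY; have [C C0 aC] := powR_le_affine a0 a1 (@ltr01 R).
apply: (integrable_linear_growth _ C0) => //; first exact: measurable_max0_powR.
move=> y; rewrite ger0_norm ?powR_ge0// (le_trans (aC _ (max0_ge0 _)))// lerD2l.
by rewrite ler_wpM2l// ge_max normr_ge0 ler_norm.
Qed.

(* For an odd increasing [u] and [Y] symmetric about [m > 0],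
   [2 E u(Y) = E (u(Y) + u(2m - Y)) = E (u(2m - Y) - u(- Y)) > 0]. *)
Lemma symmetric_power_utility_gt0 (a m : R) Y : 0 < a -> a <= 1 -> 0 < m ->
  P.-integrable setT (EFin \o Y) ->
  same_law Y (-1 *: Y + cst_rv P (2 * m)) ->
  0 < \int[P]_x power_utility a a (Y x).
Proof.
move=> a0 a1 m0 iY YY; set Y' := -1 *: Y + cst_rv P (2 * m) in YY.
have iY' : P.-integrable setT (EFin \o Y').
  rewrite (_ : _ \o _ = (fun x => (-1)%:E * (Y x)%:E + (2 * m)%:E)%E); last first.
    by apply/funext.
  apply: integrableD => //; first exact: integrableZl.
  exact: finite_measure_integrable_cst.
have iu := integrable_power_utility a0 a1 a0 a1.
have uY' := same_law_Rintegral YY (measurable_power_utility a0 a0) (iu _ iY) (iu _ iY').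
suff : 0 < \int[P]_x (power_utility a a (Y x) + power_utility a a (Y' x)).
  rewrite (RintegralD measurableT (iu _ iY) (iu _ iY')).
  by rewrite -uY' -mulr2n pmulrn_lgt0.
apply: Rintegral_gt0 => [|x].
  rewrite (_ : _ \o _ = (fun x => (power_utility a a (Y x))%:E +
      (power_utility a a (Y' x))%:E)%E); last by apply/funext.
  by apply: integrableD; rewrite ?iu.
have -> : Y' x = - Y x + 2 * m by rewrite -mulN1r.
exact: power_utility_reflection_gt0.
Qed.

(** Gains scale with exponent [a] and losses with exponent [b], so a change of position size is
    tracked on the two parts separately. *)
Lemma Rintegral_power_utilityZ (a b t : R) Y :
  0 < a -> a <= 1 -> 0 < b -> b <= 1 -> 0 <= t ->
  P.-integrable setT (EFin \o Y) ->
  \int[P]_x power_utility a b (t * Y x) =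
  t `^ a * (\int[P]_x Num.max (Y x) 0 `^ a) -
  t `^ b * (\int[P]_x Num.max (- Y x) 0 `^ b).
Proof.
move=> a0 a1 b0 b1 t0 iY.
have iNY : P.-integrable setT (EFin \o (- Y : {RV P >-> R})).
  rewrite (_ : _ \o _ = (fun x => (-1)%:E * (Y x)%:E)%E); last first.
    by apply/funext => x /=; rewrite mulN1e.
  exact: integrableZl.
have iA := integrable_max0_powR a0 a1 iY.
have iB := integrable_max0_powR b0 b1 iNY.
rewrite -!RintegralZl// -RintegralB//; first last.
- exact: (integrableZl _ _ iB).
- exact: (integrableZl _ _ iA).
apply: eq_Rintegral => x _; rewrite power_utilityE//.
have maxZ (y : R) : Num.max (t * y) 0 = t * Num.max y 0.
  by rewrite maxr_pMr// mulr0.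
by rewrite -mulrN !maxZ !powRM// max0_ge0.
Qed.

Lemma power_utility_unbounded (a b m M : R) Y :
  0 < b -> b <= a -> a <= 1 -> 0 < m ->
  P.-integrable setT (EFin \o Y) ->
  same_law Y (-1 *: Y + cst_rv P (2 * m)) ->
  exists2 t : R, 0 <= t & M <= \int[P]_x power_utility a b (t * Y x).
Proof.
move=> b0 ba a1 m0 iY YY.
have a0 : 0 < a by exact: lt_le_trans ba.
have b1 : b <= 1 by exact: le_trans a1.
have Ba0 : 0 <= \int[P]_x Num.max (- Y x) 0 `^ a.
  by apply: Rintegral_ge0 => x _; exact: powR_ge0.
have B0 : 0 <= \int[P]_x Num.max (- Y x) 0 `^ b.
  by apply: Rintegral_ge0 => x _; exact: powR_ge0.
(* Positivity of the expected odd utility, split into gains and losses by the scaling identity at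
   [t = 1]. *)
have BA : \int[P]_x Num.max (- Y x) 0 `^ a < \int[P]_x Num.max (Y x) 0 `^ a.
  have key (x y : R) : 0 < 1 `^ a * x - 1 `^ a * y -> y < x.
    by rewrite powR1 !mul1r subr_gt0.
  have := symmetric_power_utility_gt0 a0 a1 m0 iY YY.
  have -> : \int[P]_x power_utility a a (Y x) =
      \int[P]_x power_utility a a (1 * Y x).
    by apply: eq_Rintegral => x _; rewrite mul1r.
  rewrite (Rintegral_power_utilityZ a0 a1 a0 a1 ler01 iY).
  exact: key.
have A0 := le_lt_trans Ba0 BA.
(* When [a = b], [eq_ind] transports [BA] from exponent [a] to exponent [b] in the loss integral. *)
have [t t0 tM] := powR_difference_unbounded M b0 ba A0 B0
  (fun ab => eq_ind a (fun c => \int[P]_x Num.max (- Y x) 0 `^ c < _) BA b ab).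
exists t; first exact: t0.
by rewrite (Rintegral_power_utilityZ a0 a1 b0 b1 t0 iY).
Qed.

End unbounded_utility.

(** * Positive definite forms *)

Section positive_definite_form.
Context {R : realType} {d : nat}.
Variable Sigma : 'M[R]_d.
Hypothesis hSigma : sym_posdef Sigma.
Implicit Types x y z p mu : 'cV[R]_d.

Local Notation form x y := ((x^T *m Sigma *m y) 0 0).

Lemma scalar_trmx (A : 'M[R]_1) : A^T 0 0 = A 0 0.
Proof. by rewrite mxE. Qed.

Lemma form_sym x y : form x y = form y x.
Proof.
by rewrite -[LHS]scalar_trmx !trmx_mul trmxK hSigma.1 mulmxA.
Qed.

Lemma formDl x y z : form (x + y) z = form x z + form y z.
Proof. by rewrite linearD/= !mulmxDl mxE. Qed.

Lemma formZl (c : R) x y : form (c *: x) y = c * form x y.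
Proof. by rewrite linearZ/= -!scalemxAl mxE. Qed.

Lemma form0l y : form (0 : 'cV[R]_d) y = 0.
Proof. by rewrite trmx0 !mul0mx mxE. Qed.

Lemma form_ge0 x : 0 <= form x x.
Proof.
have [->|x0] := eqVneq x 0; first by rewrite form0l.
by rewrite ltW// hSigma.2.
Qed.

Lemma form_CauchySchwarz x y :
  `|form x y| <= Num.sqrt (form x x) * Num.sqrt (form y y).
Proof.
rewrite -sqrtrM ?form_ge0// -sqrtr_sqr ler_wsqrtr//.
have [->|y0] := eqVneq y 0; first by rewrite form_sym !form0l mulr0 expr0n.
have yy := hSigma.2 y y0.
(* The minimizer of the quadratic [form (x + t *: y) (x + t *: y)] in [t]. *)
pose t := - (form x y / form y y).
have := form_ge0 (x + t *: y).
have -> : form (x + t *: y) (x + t *: y) =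
    form x x - form x y ^+ 2 / form y y.
  rewrite formDl formZl !(form_sym _ (x + t *: y)) !formDl !formZl.
  by rewrite (form_sym y x) /t; field; rewrite gt_eqF.
by rewrite subr_ge0 ler_pdivrMr.
Qed.

(** A nonzero vector in the kernel would have zero form. *)
Lemma posdef_unitmx : Sigma \in unitmx.
Proof.
rewrite -row_free_unit; apply/negPn/negP; rewrite -kermx_eq0.
case/rowV0Pn => v /sub_kermxP vS v0.
have := hSigma.2 v^T; rewrite trmxK vS mul0mx mxE ltxx.
by move/(_ _)/notF; apply; rewrite -(inj_eq (@trmx_inj _ _ _)) trmxK trmx0.
Qed.

(** [invmx Sigma *m mu] represents the mean functional for the form, so Cauchy-Schwarz bounds means
    by deviations. *)
Lemma form_invmx p mu : form p (invmx Sigma *m mu) = (p^T *m mu) 0 0.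
Proof. by rewrite mulmxA mulmxK ?posdef_unitmx. Qed.

Lemma form_invmx_invmx mu :
  form (invmx Sigma *m mu) (invmx Sigma *m mu) =
  (mu^T *m invmx Sigma *m mu) 0 0.
Proof.
by rewrite form_invmx -[LHS]scalar_trmx trmx_mul trmxK mulmxA.
Qed.

(** Each coordinate is a linear functional, represented by [e i], so Cauchy-Schwarz applies; summing
    the norms of the [e i] gives one constant for all [i]. *)
Lemma coordinate_le_form : exists2 C : R, 0 <= C &
  forall p i, `|p i 0| <= C * Num.sqrt (form p p).
Proof.
pose e i : 'cV[R]_d := invmx Sigma *m delta_mx i 0.
exists (\sum_i Num.sqrt (form (e i) (e i))) => [|p i].
  by apply: sumr_ge0 => i _; exact: sqrtr_ge0.
have -> : p i 0 = form p (e i).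
  rewrite form_invmx mxE (bigD1 i)//= !mxE !eqxx mulr1 big1 ?addr0// => j ji.
  by rewrite !mxE (negbTE ji) mulr0.
rewrite (le_trans (form_CauchySchwarz _ _))// mulrC ler_wpM2r ?sqrtr_ge0//.
by rewrite (bigD1 i)//= lerDl; apply: sumr_ge0 => j _; exact: sqrtr_ge0.
Qed.

Lemma mean_le_sharpe mu p :
  (p^T *m mu) 0 0 <=
  Num.sqrt ((mu^T *m invmx Sigma *m mu) 0 0) * Num.sqrt (form p p).
Proof.
rewrite -form_invmx -form_invmx_invmx mulrC.
exact: le_trans (ler_norm _) (form_CauchySchwarz _ _).
Qed.

Lemma SRmaxE mu : (0 < d)%N ->
  SRmax mu Sigma = Num.sqrt ((mu^T *m invmx Sigma *m mu) 0 0).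
Proof.
move=> d0; set s := Num.sqrt _; rewrite /SRmax.
set A := [set _ | _ in _].
have ubA : ubound A s.
  move=> _ [p /= p0 <-]; rewrite ler_pdivrMr ?mean_le_sharpe//.
  by rewrite sqrtr_gt0 hSigma.2.
have As : A s.
  (* The supremum is attained: at [invmx Sigma *m mu] if [mu] is nonzero, and otherwise at any
     nonzero vector, which exists because [0 < d]. *)
  have [mu0|mu0] := eqVneq mu 0.
    exists (const_mx 1).
      apply/eqP => /matrixP/(_ (Ordinal d0) 0); rewrite !mxE => /eqP.
      by rewrite oner_eq0.
    by rewrite /s mu0 !mulmx0 mxE mul0r sqrtr0.
  have h0 : invmx Sigma *m mu != 0.
    apply: contra mu0 => /eqP h.
    by rewrite -(mulKVmx posdef_unitmx mu) h mulmx0.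
  exists (invmx Sigma *m mu) => //.
  rewrite -form_invmx form_invmx_invmx -/s -{1}[(_ *m mu) 0 0]sqr_sqrtr.
    by rewrite expr2 mulfK// gt_eqF// sqrtr_gt0 -form_invmx_invmx hSigma.2.
  by rewrite -form_invmx_invmx form_ge0.
apply/eqP; rewrite eq_le; apply/andP; split.
  by apply: ge_sup => //; exists s.
by apply: ub_le_sup => //; exists s.
Qed.

End positive_definite_form.

(** * Risk functionals on Gaussian positions *)

Section risk_functionals.
Context {disp : measure_display} {T : measurableType disp} {R : realType}.
Context {P : probability T R} {L : set {RV P >-> R}}.
Context {rho : {RV P >-> R} -> \bar R}.
Hypothesis hL : law_invariant_riesz_space L.
Implicit Types Y Z : {RV P >-> R}.

Lemma riesz_cst (c : R) : L (cst_rv P c).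
Proof. by apply: (riesz_Linfty hL); exact: Lfun_pinfty_cst. Qed.

Lemma riesz_add Y Z : L Y -> L Z -> L (Y + Z).
Proof. by move=> LY LZ; have := riesz_linear hL 1 LY LZ; rewrite scale1r. Qed.

Lemma riesz_scale (k : R) Y : L Y -> L (k *: Y).
Proof.
move=> LY; have := riesz_linear hL k LY (riesz_cst 0).
by congr L; apply/mfuneqP => x /=; rewrite addr0.
Qed.

Lemma riesz_sum (d : nat) (p : 'I_d -> R) (X : 'I_d -> {RV P >-> R}) :
  (forall i, L (X i)) -> L (\sum_(i < d) p i *: X i).
Proof.
move=> LX; apply: (big_ind L).
- by have := riesz_cst 0; congr L; apply/mfuneqP.
- exact: riesz_add.
- by move=> i _; exact: riesz_scale.
Qed.

Lemma riesz_integrable Y : L Y -> P.-integrable setT (EFin \o Y).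
Proof. by move=> /(riesz_L1 hL)/Lfun1_integrable. Qed.

Hypothesis hrho : risk_functional L rho.
Hypothesis hcash : cash_additive L rho.
Hypothesis hhom : positively_homogeneous L rho.

(** Positive homogeneity settles [c > 0]. Cash-additivity, with the finite value at [1] cancelled,
    gives zero at [0], and applied to [- c + c] it then settles [c < 0]. *)
Lemma risk_cst_linear (c : R) : rho (cst_rv P c) = (c%:E * rho (cst_rv P 1))%E.
Proof.
have fin1 : rho (cst_rv P 1) \is a fin_num by exact: (risk_cst hrho).
have pos (k : R) : 0 < k -> rho (cst_rv P k) = (k%:E * rho (cst_rv P 1))%E.
  move=> k0; rewrite -hhom//; last exact: riesz_cst.
  by congr rho; apply/mfuneqP => x; exact/esym/mulr1.
have zero : rho (cst_rv P 0) = 0%E.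
  have := hcash 0 (riesz_cst 1).
  have -> : cst_rv P 1 + cst_rv P 0 = cst_rv P 1.
    by apply/mfuneqP => x /=; rewrite addr0.
  case: (rho (cst_rv P 1)) fin1 => // t _.
  case: (rho (cst_rv P 0)) => [z| |]// [] /eqP.
  by rewrite -subr_eq0 opprD addrA subrr sub0r oppr_eq0 => /eqP ->.
have [c0|c0|->] := ltgtP c 0; [|exact: pos|by rewrite mul0e].
have := hcash c (riesz_cst (- c)).
have -> : cst_rv P (- c) + cst_rv P c = cst_rv P 0.
  by apply/mfuneqP => x /=; rewrite addNr.
rewrite zero pos ?oppr_gt0//.
case: (rho (cst_rv P 1)) fin1 => // t _.
case: (rho (cst_rv P c)) => [z| |]// [] /eqP.
by rewrite mulNr eq_sym addrC subr_eq0 => /eqP ->.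
Qed.

Hypothesis hlaw : law_invariant L rho.
Variable Z : {RV P >-> R}.
Hypothesis hZ : has_law Z (normal_law 0 1).
Hypothesis hrho1 : rho (cst_rv P 1) != 0%E.
Hypothesis hkappa0 : (0 < rho Z / `|rho (cst_rv P 1)|)%E.
Hypothesis hkappaoo : (rho Z / `|rho (cst_rv P 1)| < +oo)%E.

(** Monotonicity gives [rho 1 <= rho 0 = 0], hence [l > 0]. Finiteness of [rho Z] follows from that
    of the ratio [k], so later computations take place in the reals. *)
Lemma risk_normal_scale : L Z -> exists l k : R,
  [/\ 0 < l, 0 < k, rho (cst_rv P 1) = (- l)%:E, rho Z = (l * k)%:E &
      (rho Z / `|rho (cst_rv P 1)|)%E = k%:E].
Proof.
move=> LZ.
have fin1 : rho (cst_rv P 1) \is a fin_num by exact: (risk_cst hrho).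
have le0 : (rho (cst_rv P 1) <= 0)%E.
  have -> : 0%E = rho (cst_rv P 0) by rewrite risk_cst_linear mul0e.
  apply: (risk_decreasing hrho); [exact: riesz_cst|exact: riesz_cst|].
  by apply: aeW => x /=.
have ZNy := risk_gtNy hrho LZ.
move: fin1 le0 ZNy hkappa0 hkappaoo hrho1.
case: (rho (cst_rv P 1)) => // t _; rewrite lee_fin => t0 + + + tn0.
have tlt0 : t < 0 by rewrite lt_neqAle tn0.
have -> : `|t%:E|%E = (- t)%:E by rewrite /= ltr0_norm.
rewrite inver oppr_eq0 (lt_eqF tlt0).
case: (rho Z) => [z| |]// _; last first.
  by rewrite gt0_mulye ?ltxx// lte_fin invr_gt0 oppr_gt0.
rewrite -EFinM lte_fin => k0 _.
exists (- t), (z / - t); split => //.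
- by rewrite oppr_gt0.
- by rewrite opprK.
- by rewrite mulrC divfK// oppr_eq0 lt_eqF.
Qed.

Lemma risk_normal (m v : R) Y : L Y -> L Z -> 0 <= v ->
  has_law Y (normal_law m v) ->
  rho Y = ((Num.sqrt v)%:E * rho Z + m%:E * rho (cst_rv P 1))%E.
Proof.
move=> LY LZ v0 lY.
have YZ := same_law_normal v0 lY hZ.
rewrite (hlaw LY _ YZ); last by apply: riesz_add; [exact: riesz_scale|exact: riesz_cst].
(* Homogeneity covers only positive factors; at deviation zero the position is a constant. *)
have [s0|s0] := eqVneq (Num.sqrt v) 0.
  rewrite s0 mul0e add0e -risk_cst_linear; congr rho.
  by apply/mfuneqP => x /=; rewrite scale0r add0r.
rewrite hcash; last exact: riesz_scale.
by rewrite risk_cst_linear hhom// lt0r s0 sqrtr_ge0.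
Qed.

End risk_functionals.

(** * Portfolios *)

Section portfolios.
Context {disp : measure_display} {T : measurableType disp} {R : realType}.
Context {P : probability T R} {d : nat}.
Variable X : 'I_d -> {RV P >-> R}.
Implicit Types p : 'cV[R]_d.

Definition excess p : {RV P >-> R} := \sum_(i < d) p i 0 *: X i.

(** The riskless holding closes the budget, so the risky positions parametrize the budget set
    without constraint. *)
Definition portfolio (w : R) p : 'I_d.+1 -> R :=
  fun i => if unlift ord0 i is Some j then p j 0 else w - \sum_j p j 0.

Lemma excessE p x : excess p x = \sum_(i < d) p i 0 * X i x.
Proof. by apply: (big_ind2 (fun (f : {RV P >-> R}) y => f x = y)) => // f _ g _ <- <-. Qed.

Lemma excessZ t p x : excess (t *: p) x = t * excess p x.
Proof.
rewrite !excessE mulr_sumr; apply: eq_bigr => i _.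
by rewrite mxE mulrA.
Qed.

Lemma initial_wealth_market (theta : 'I_d.+1 -> R) :
  initial_wealth (@market_S0 R d) theta = \sum_(i < d.+1) theta i.
Proof. by apply: eq_bigr => i _; rewrite mulr1. Qed.

(** Every asset costs [1] and pays at least the component [1 + r], so the riskless return accrues on
    the whole initial wealth. *)
Lemma terminal_wealth_market (r : R) (theta : 'I_d.+1 -> R) :
  terminal_wealth (market_S1 r X) theta =
  excess (\col_j theta (lift ord0 j)) +
    cst_rv P (initial_wealth (@market_S0 R d) theta * (1 + r)).
Proof.
apply/mfuneqP => x.
have twE : terminal_wealth (market_S1 r X) theta x =
    \sum_(i < d.+1) theta i * market_S1 r X i x.
  by apply: (big_ind2 (fun (f : {RV P >-> R}) y => f x = y)) => // f _ g _ <- <-.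
transitivity (excess (\col_j theta (lift ord0 j)) x +
    initial_wealth (@market_S0 R d) theta * (1 + r)); last by [].
rewrite twE excessE initial_wealth_market !big_ord_recl /market_S1 unlift_none/=.
rewrite mulrDl addrCA; congr (_ + _).
rewrite mulr_suml -big_split/=; apply: eq_bigr => i _.
by rewrite liftK mxE/= mulrDr addrC.
Qed.

Lemma initial_wealth_portfolio (w : R) p :
  initial_wealth (@market_S0 R d) (portfolio w p) = w.
Proof.
rewrite initial_wealth_market big_ord_recl /portfolio unlift_none /=.
by under [X in _ + X]eq_bigr do rewrite liftK; rewrite subrK.
Qed.

Lemma terminal_wealth_portfolio (r w : R) p :
  terminal_wealth (market_S1 r X) (portfolio w p) =
  excess p + cst_rv P (w * (1 + r)).
Proof.
rewrite terminal_wealth_market initial_wealth_portfolio; congr (excess _ + _).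
by apply/colP => j; rewrite mxE /portfolio liftK.
Qed.

End portfolios.

(** * Continuity of the expected utility in the risky position *)

Lemma ler_coord_mx_norm (R : realType) (m n : nat) (M : 'M[R]_(m, n)) i j :
  `|M i j| <= `|M|.
Proof. by rewrite [leRHS]/Num.norm/= mx_normrE (le_bigmax _ _ (i, j)). Qed.

Section expected_utility_continuity.
Context {disp : measure_display} {T : measurableType disp} {R : realType}.
Context {P : probability T R} {d : nat}.
Variable X : 'I_d -> {RV P >-> R}.
Hypothesis iX : forall i, P.-integrable setT (EFin \o X i).
Variables a b : R.
Hypotheses (a0 : 0 < a) (a1 : a <= 1) (b0 : 0 < b) (b1 : b <= 1).

Lemma integrable_wealth (c : R) (p : 'cV[R]_d) :
  P.-integrable setT (EFin \o (excess X p + cst_rv P c : {RV P >-> R})).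
Proof.
rewrite (_ : _ \o _ =
    (fun x => (\sum_(i < d) (p i 0)%:E * (X i x)%:E) + c%:E)%E); last first.
  apply/funext => x; rewrite -[LHS]/((excess X p x + c)%:E) excessE EFinD.
  by rewrite -sumEFin.
apply: integrableD => //; last exact: finite_measure_integrable_cst.
apply: integrable_sum => // i _.
by apply: integrableZl => //; exact: iX.
Qed.

(** The modulus of continuity bounds the change by [e / 2 + C * |v - v'| * I], where [I] is the
    expectation of the sum of the [|X i|]. *)
Lemma continuous_expected_utility (c : R) :
  continuous (fun v : 'rV[R]_d =>
    \int[P]_x power_utility a b ((excess X v^T + cst_rv P c : {RV P >-> R}) x)).
Proof.
set W : 'rV[R]_d -> {RV P >-> R} := fun v => excess X v^T + cst_rv P c.
set u := power_utility a b.
move=> v.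
have Fv : ProperFilter (nbhs v) by exact: nbhs_pfilter.
apply/(@cvgrPdist_le _ _ _ (nbhs v) Fv) => e e0.
have e20 : 0 < e / 2 by rewrite divr_gt0.
have [C C0 uC] := power_utility_modulus a0 a1 b0 b1 e20.
pose Y x : R := \sum_(i < d) `|X i x|.
have iY : P.-integrable setT (EFin \o Y).
  rewrite (_ : _ \o _ = (fun x => \sum_(i < d) (`|X i x|)%:E)%E); last first.
    by apply/funext => x /=; rewrite sumEFin.
  by apply: integrable_sum => // i _; apply: integrable_norm => //; exact: iX.
pose I := \int[P]_x Y x.
have I0 : 0 <= I by apply: Rintegral_ge0 => x _; apply: sumr_ge0.
(* The summand [1] keeps the radius below well defined when [C * I] is zero. *)
have CI0 : 0 < C * I + 1 by rewrite ltr_wpDl// mulr_ge0.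
have iu v' : P.-integrable setT (EFin \o (u \o W v')).
  by apply: integrable_power_utility => //; exact: integrable_wealth.
have D0 : 0 < e / 2 / (C * I + 1) by rewrite divr_gt0.
near=> v'.
have vv' : `|v - v'| <= e / 2 / (C * I + 1).
  by near: v'; apply: cvgr_dist_le.
rewrite -RintegralB//; [|exact: iu|exact: iu].
have iB : P.-integrable setT (EFin \o (fun x => u (W v x) - u (W v' x))).
  exact: (integrableB _ (iu v) (iu v')).
apply: le_trans (le_normr_Rintegral _ iB) _ => //.
apply: (@le_trans _ _ (\int[P]_x (e / 2 + C * `|v - v'| * Y x))).
  apply: le_Rintegral => //.
  - exact: integrable_norm.
  - rewrite (_ : _ \o _ =
      (fun x => (e / 2)%:E + (C * `|v - v'|)%:E * (Y x)%:E)%E)//.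
    apply: integrableD => //; first exact: finite_measure_integrable_cst.
    exact: integrableZl.
  - move=> x _; rewrite (le_trans (uC _ _))// lerD2l -mulrA ler_wpM2l//.
    have -> : W v x - W v' x = \sum_(i < d) (v - v') 0 i * X i x.
      rewrite -[W v x]/(excess X v^T x + c) -[W v' x]/(excess X v'^T x + c).
      rewrite opprD addrACA subrr addr0 !excessE -sumrB.
      by apply: eq_bigr => i _; rewrite !mxE mulrBl.
    rewrite (le_trans (ler_norm_sum _ _ _))// mulr_sumr.
    apply: ler_sum => i _.
    by rewrite normrM ler_wpM2r// ler_coord_mx_norm.
rewrite RintegralD//; first last.
- exact: (integrableZl _ _ iY).
- exact: finite_measure_integrable_cst.
rewrite Rintegral_cst// (_ : fine _ = 1) ?mulr1; last first.
  by rewrite [X in fine X](probability_setT P).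
rewrite RintegralZl// -/I.
rewrite [leRHS](splitr e) lerD2l.
apply: (@le_trans _ _ (C * (e / 2 / (C * I + 1)) * I)).
  by rewrite ler_wpM2r// ler_wpM2l.
have -> : C * (e / 2 / (C * I + 1)) * I = e / 2 * ((C * I) / (C * I + 1)).
  by field; rewrite gt_eqF.
rewrite ler_piMr ?(ltW e20)// ler_pdivrMr// mul1r lerDl//.
Unshelve. all: by end_near. Qed.

End expected_utility_continuity.

(** * The Gaussian market *)

Lemma continuous_sum (S : topologicalType) (R : realType) (I : Type)
    (s : seq I) (f : I -> S -> R) :
  (forall i, continuous (f i)) -> continuous (fun x => \sum_(i <- s) f i x).
Proof.
move=> cf; elim: s => [|i s IH] x.
  under eq_fun do rewrite big_nil.
  exact: cvg_cst.
under eq_fun do rewrite big_cons.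
by apply: cvgD; [exact: cf|exact: IH].
Qed.

Lemma continuous_rV_mulmx (R : realType) (d : nat) (mu : 'cV[R]_d) :
  continuous (fun v : 'rV[R]_d => (v *m mu) 0 0).
Proof.
under eq_fun do rewrite mxE.
apply: continuous_sum => i x.
apply: continuousM.
  exact: (@coord_continuous R 1 d 0 i x).
exact: cst_continuous.
Qed.

Lemma continuous_rV_form (R : realType) (d : nat) (Sigma : 'M[R]_d) :
  continuous (fun v : 'rV[R]_d => (v *m Sigma *m v^T) 0 0).
Proof.
have -> : (fun v : 'rV[R]_d => (v *m Sigma *m v^T) 0 0) =
    (fun v : 'rV[R]_d => \sum_j (v *m col j Sigma) 0 0 * v 0 j).
  apply/funext => v; rewrite mxE; apply: eq_bigr => j _; rewrite !mxE.
  by congr (_ * _); apply: eq_bigr => i _; rewrite !mxE.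
apply: continuous_sum => j x.
apply: continuousM; first exact: (@continuous_rV_mulmx R d (col j Sigma) x).
exact: (@coord_continuous R 1 d 0 j x).
Qed.

Section gaussian_market.
Context {disp : measure_display} {T : measurableType disp} {R : realType}.
Context {P : probability T R} {L : set {RV P >-> R}}.
Context {rho : {RV P >-> R} -> \bar R}.
Context {d : nat} {mu : 'cV[R]_d} {Sigma : 'M[R]_d} {X : 'I_d -> {RV P >-> R}}.
Context {Z : {RV P >-> R}}.
Hypothesis hL : law_invariant_riesz_space L.
Hypothesis hd : (0 < d)%N.
Hypothesis hSigma : sym_posdef Sigma.
Hypothesis hX : multivariate_normal mu Sigma X.
Hypothesis hXL : forall i, L (X i).
Hypothesis hZ : has_law Z (normal_law 0 1).

Local Notation form p := ((p^T *m Sigma *m p) 0 0).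
Local Notation mean p := ((p^T *m mu) 0 0).

Lemma riesz_excess (p : 'cV[R]_d) : L (excess X p).
Proof. exact: riesz_sum. Qed.

(** Standardizing one nondegenerate asset excess gives a standard normal variable in [L];
    law-invariance of [L] carries membership over to [Z]. *)
Lemma riesz_std_normal : L Z.
Proof.
pose p : 'cV[R]_d := delta_mx (Ordinal hd) 0.
have p0 : p != 0.
  by apply/eqP => /matrixP/(_ (Ordinal hd) 0)/eqP; rewrite !mxE !eqxx oner_eq0.
have v0 := hSigma.2 p p0.
have s0 : Num.sqrt (form p) != 0 by rewrite gt_eqF// sqrtr_gt0.
have YZ := same_law_normal (ltW v0) (hX p) hZ.
have := same_law_affine (Num.sqrt (form p))^-1 (- mean p / Num.sqrt (form p)) YZ.
set Y' := (X in same_law X _); set Z' := (X in same_law _ X).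
have -> : Z' = Z.
  apply/mfuneqP => x; rewrite /Z'.
  rewrite -[LHS]/((Num.sqrt (form p))^-1 *
    (Num.sqrt (form p) * Z x + mean p) + (- mean p / Num.sqrt (form p))).
  by field.
move=> Y'Z; apply: (riesz_law hL _ (same_law_sym Y'Z)).
apply: riesz_add => //; last exact: riesz_cst.
by apply: riesz_scale => //; exact: riesz_excess.
Qed.

(** Joint normality is used at [p] and at [- p]. With [s] the deviation and [m] the mean of [p],
    both sides then have the law of [- s * Z + m], without a separate symmetry argument for [Z]. *)
Lemma excess_symmetric (p : 'cV[R]_d) :
  same_law (excess X p) (-1 *: excess X p + cst_rv P (2 * mean p)).
Proof.
have v0 := form_ge0 hSigma p.
have YZ := same_law_normal v0 (hX p) hZ.
have := same_law_normal (form_ge0 hSigma (- p)) (hX (- p)) hZ.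
have NT : (- p)^T = - p^T by rewrite linearN.
have -> : form (- p) = form p by rewrite NT !mulNmx mulmxN opprK.
have -> : mean (- p) = - mean p by rewrite NT mulNmx mxE.
rewrite -/(excess X (- p)) => /(same_law_affine (-1) 0).
have -> : -1 *: excess X (- p) + cst_rv P 0 = excess X p.
  apply/mfuneqP => x; rewrite -[LHS]/(-1 * excess X (- p) x + 0).
  have -> : excess X (- p) x = -1 * excess X p x by rewrite -excessZ scaleN1r.
  by ring.
move=> YZ'; apply: same_law_trans YZ' _; apply: same_law_sym.
have := same_law_affine (-1) (2 * mean p) YZ.
set U := (X in same_law _ X -> _); set V := (X in _ -> same_law _ X).
suff -> : U = V by [].
apply/mfuneqP => x.
rewrite -[LHS]/(-1 * (Num.sqrt (form p) * Z x + mean p) + 2 * mean p).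
rewrite -[RHS]/(-1 * (Num.sqrt (form p) * Z x + - mean p) + 0).
by ring.
Qed.

Hypothesis hrho : risk_functional L rho.
Hypothesis hlaw : law_invariant L rho.
Hypothesis hcash : cash_additive L rho.
Hypothesis hhom : positively_homogeneous L rho.

Lemma risk_wealth (l k c : R) (p : 'cV[R]_d) :
  rho (cst_rv P 1) = (- l)%:E -> rho Z = (l * k)%:E ->
  rho (excess X p + cst_rv P c) =
  (l * (k * Num.sqrt (form p) - (c + mean p)))%:E.
Proof.
move=> rho1 rhoZ.
rewrite hcash; last exact: riesz_excess.
rewrite (risk_normal hL hrho hcash hhom hlaw hZ _ _ _ (hX p)); last 3 first.
- exact: riesz_excess.
- exact: riesz_std_normal.
- exact: form_ge0.
rewrite (risk_cst_linear hL hrho hcash hhom c) rho1 rhoZ -!EFinM -!EFinD.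
by congr EFin; ring.
Qed.

(** The constraint and [mean <= SRmax * s] give [(k - SRmax) * s <= M / l + c] for the deviation
    [s], which bounds every coordinate; continuity of the risk gives closedness. *)
Lemma compact_feasible (l k c M : R) :
  0 < l -> SRmax mu Sigma < k ->
  compact [set v : 'rV[R]_d |
    l * (k * Num.sqrt (form v^T) - (c + mean v^T)) <= M].
Proof.
move=> l0 SRk; apply: bounded_closed_compact.
  have [C C0 HC] := coordinate_le_form hSigma.
  pose K := C * ((M / l + c) / (k - SRmax mu Sigma)).
  (* The absolute value keeps the bound nonnegative even when [M / l + c] is negative. *)
  exists `|K|; split; first exact: num_real.
  move=> N KN v /= Hv.
  rewrite [leLHS]/Num.norm/= mx_normrE; apply: bigmax_le => [|[i j] _].
    by rewrite ltW// (le_lt_trans _ KN).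
  rewrite /= ord1.
  have -> : v 0 j = v^T j 0 by rewrite mxE.
  rewrite (le_trans (HC _ _))// (le_trans _ (ltW KN))//.
  rewrite (le_trans _ (ler_norm K))// ler_wpM2l// ler_pdivlMr ?subr_gt0//.
  have := mean_le_sharpe hSigma mu v^T; rewrite -SRmaxE// => h.
  have {}Hv : k * Num.sqrt (form v^T) - (c + mean v^T) <= M / l.
    by rewrite ler_pdivlMr// mulrC.
  nra.
have cF : continuous (fun v : 'rV[R]_d =>
    l * (k * Num.sqrt ((v *m Sigma *m v^T) 0 0) - (c + (v *m mu) 0 0))).
  move=> v; apply: (@continuousM R _ (fun=> l) (fun v : 'rV[R]_d =>
    k * Num.sqrt ((v *m Sigma *m v^T) 0 0) - (c + (v *m mu) 0 0))).
    exact: cst_continuous.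
  apply: continuousB.
    apply: continuousM; first exact: cst_continuous.
    apply: continuous_comp; first exact: (@continuous_rV_form R d Sigma v).
    exact: sqrt_continuous.
  apply: continuousD; first exact: cst_continuous.
  exact: (@continuous_rV_mulmx R d mu v).
rewrite [X in closed X](_ : _ =
  (fun v : 'rV[R]_d => l * (k * Num.sqrt ((v *m Sigma *m v^T) 0 0) -
    (c + (v *m mu) 0 0))) @^-1` [set x | x <= M]); last first.
  by apply/seteqP; split => v /=; rewrite trmxK.
by apply: preimage_closed; [move=> v _; exact: cF|exact: closed_le].
Qed.

End gaussian_market.

(** * Equivalence of the Sharpe ratio bound with both forms of well-posedness *)

Unset Implicit Arguments.
Set Strict Implicit.
Set Printing Implicit Defensive.

Theorem theorem6p8 (disp : measure_display) (T : measurableType disp)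
    (R : realType) (P : probability T R)
    (L : set {RV P >-> R}) (rho : {RV P >-> R} -> \bar R)
    (d : nat) (mu : 'cV[R]_d) (Sigma : 'M[R]_d) (X : 'I_d -> {RV P >-> R})
    (r : R) (Z : {RV P >-> R}) (a b : R)
    (hP : atomless P)
    (hL : law_invariant_riesz_space L)
    (hd : (0 < d)%N)
    (hSigma : sym_posdef Sigma)
    (hX : multivariate_normal mu Sigma X)
    (hXL : forall i, L (X i))
    (hr : -1 < r)
    (hrho : risk_functional L rho)
    (hlaw : law_invariant L rho)
    (hcash : cash_additive L rho)
    (hhom : positively_homogeneous L rho)
    (hfatou : lower_fatou L rho)
    (hZ : has_law Z (normal_law 0 1))
    (hrho1 : rho (cst_rv P 1) != 0%E)
    (hkappa0 : (0 < rho Z / `|rho (cst_rv P 1)|)%E)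
    (hkappaoo : (rho Z / `|rho (cst_rv P 1)| < +oo)%E)
    (hb : 0 < b) (hba : b <= a) (ha : a <= 1) :
  let u := power_utility a b in
  let kappa := (rho Z / `|rho (cst_rv P 1)|)%E in
  let S0 := @market_S0 R d in
  let S1 := market_S1 r X in
  SRmax mu Sigma = Num.sqrt ((mu^T *m invmx Sigma *m mu) 0 0) /\
  ((((SRmax mu Sigma)%:E < kappa)%E <-> weakly_well_posed S0 S1 r u rho) /\
   (weakly_well_posed S0 S1 r u rho <-> well_posed S0 S1 r u rho)).
Proof.
move=> u kappa S0 S1.
have a0 : 0 < a by exact: lt_le_trans hba.
have b1 : b <= 1 by exact: le_trans ha.
have LZ := riesz_std_normal hL hd hSigma hX hXL hZ.
have [l [k [l0 k0 rho1 rhoZ kappaE]]] :=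
  risk_normal_scale hL hrho hcash hhom hrho1 hkappa0 hkappaoo LZ.
have iX i : P.-integrable setT (EFin \o X i) by exact: (riesz_integrable hL (hXL i)).
have riskE := risk_wealth hL hd hSigma hX hXL hZ hrho hlaw hcash hhom _ _ rho1 rhoZ.
have iu c p : P.-integrable setT
    (EFin \o (u \o (excess X p + cst_rv P c : {RV P >-> R}))).
  by apply: integrable_power_utility => //; exact: integrable_wealth.
have EUE c p := expected_utility_Rintegral (iu c p).
have uoo : expected_utility_infty u = +oo%E by exact: expected_utility_infty_power.
have wealthE theta : exists p, terminal_wealth S1 theta =
    excess X p + cst_rv P (initial_wealth S0 theta * (1 + r)).
  by eexists; exact: terminal_wealth_market.
have ac : SRmax mu Sigma < k -> well_posed S0 S1 r u rho.
  move=> SRk w M w0; rewrite (risk_cst_linear hL hrho hcash hhom) rho1 -EFinM lee_fin => cM.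
  have cA := @compact_feasible _ _ _ _ hd hSigma l k (w * (1 + r)) M l0 SRk.
  set A := [set v | _] in cA.
  (* The purely riskless position is feasible, precisely by the lower bound imposed on the risk
     limit. *)
  have A0 : A !=set0.
    exists 0; rewrite /A/= !trmx0 !mul0mx !mxE sqrtr0 mulr0 addr0 sub0r mulrN.
    by rewrite -mulNr mulrC.
  have [v /set_mem vA vmax] := compact_EVT_max A0 cA (continuous_subspaceT
    (@continuous_expected_utility _ _ _ _ _ _ iX _ _ a0 ha hb b1 (w * (1 + r)))).
  exists (portfolio w v^T).
    split; first exact: initial_wealth_portfolio.
    by rewrite terminal_wealth_portfolio riskE lee_fin.
  move=> eta [etaw etaM]; rewrite terminal_wealth_portfolio.
  have [p pE] := wealthE eta; move: etaM; rewrite pE etaw riskE !EUE !lee_fin => etaM.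
  by have := vmax p^T; rewrite trmxK; apply; apply/mem_set; rewrite /A/= !trmxK.
(* The maximal value is a finite expectation, whereas the utility at infinity is [+oo]. *)
have cb : well_posed S0 S1 r u rho -> weakly_well_posed S0 S1 r u rho.
  move=> wp w M w0 cM; have [theta _ thetamax] := wp w M w0 cM.
  have [p pE] := wealthE theta.
  rewrite uoo (@le_lt_trans _ _ (expected_utility u (terminal_wealth S1 theta)))//.
    by apply: ge_ereal_sup => _ [eta etaA <-]; exact: thetamax.
  by rewrite pE EUE ltry.
have ba : weakly_well_posed S0 S1 r u rho -> SRmax mu Sigma < k.
  move=> wwp; rewrite ltNge; apply/negP => kSR.
  pose h := invmx Sigma *m mu; pose s := SRmax mu Sigma.
  have sE : s = Num.sqrt ((h^T *m Sigma *m h) 0 0).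
    by rewrite /s SRmaxE// form_invmx_invmx.
  (* Since [k > 0], failure of the Sharpe bound forces a positive Sharpe ratio, hence a positive
     mean along [h]. *)
  have s0 : 0 < s by exact: lt_le_trans kSR.
  have mE : (h^T *m mu) 0 0 = s ^+ 2.
    by rewrite sE sqr_sqrtr ?form_ge0// form_invmx.
  have m0 : 0 < (h^T *m mu) 0 0 by rewrite mE exprn_gt0.
  have ih : P.-integrable setT (EFin \o excess X h).
    by apply: (riesz_integrable hL); exact: riesz_excess.
  (* Unit wealth with the smallest permitted limit, the risk of the riskless payoff [1 + r]. *)
  have := wwp 1 (- (l * (1 + r))) ltr01.
  rewrite (risk_cst_linear hL hrho hcash hhom) rho1 -EFinM lee_fin uoo.
  have -> : 1 * (1 + r) * - l <= - (l * (1 + r)) by rewrite mul1r mulrN mulrC.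
  move=> /(_ isT); apply/negP; rewrite -leNgt leye_eq; apply/eqP/eqyP => M _.
  have [t t0 tM] := power_utility_unbounded M hb hba ha m0 ih
    (excess_symmetric hSigma hX hZ h).
  apply: (@le_trans _ _ (expected_utility u (terminal_wealth S1 (portfolio 1 (t *: h))))).
    rewrite terminal_wealth_portfolio EUE lee_fin; apply: (le_trans tM).
    have itY : P.-integrable setT
        (EFin \o (fun x => power_utility a b (t * excess X h x))).
      have := integrable_power_utility a0 ha hb b1
        (riesz_integrable hL (riesz_scale hL t (riesz_excess hL hXL h))).
      exact.
    apply: le_Rintegral => //; first exact: iu.
    (* The riskless payoff [1 + r] is positive, so adding it to the excess only raises the
       utility. *)
    move=> x _; apply: ler_power_utility => //.
    rewrite -[leRHS]/(excess X (t *: h) x + 1 * (1 + r)) excessZ lerDl; lra.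
  apply: ereal_sup_ubound; exists (portfolio 1 (t *: h)) => //.
  split; first exact: initial_wealth_portfolio.
  rewrite terminal_wealth_portfolio riskE lee_fin.
  (* Along the ray the mean is [t * s ^+ 2] and the deviation [t * s], so the risk constraint
     becomes [0 <= t * s * (s - k)]. *)
  have -> : ((t *: h)^T *m mu) 0 0 = t * s ^+ 2.
    by rewrite -mE linearZ/= -scalemxAl mxE.
  have -> : ((t *: h)^T *m Sigma *m (t *: h)) 0 0 = (t * s) ^+ 2.
    rewrite formZl (form_sym hSigma) formZl sE exprMn sqr_sqrtr ?form_ge0//.
    by rewrite mulrA.
  rewrite sqrtr_sqr ger0_norm ?mulr_ge0 ?(ltW s0)// -mulrN ler_pM2l// mul1r.
  have : 0 <= t * s * (s - k) by rewrite mulr_ge0 ?subr_ge0// mulr_ge0// ltW.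
  by rewrite expr2; lra.
split; first exact: SRmaxE.
rewrite /kappa kappaE lte_fin; split; split => //.
- by move=> /ac/cb.
- by move=> /ba/ac.
Qed.
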